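(* Let $\mathfrak{X}=(X,\{R_i\}_{i=0}^d)$ be a symmetric association scheme of class $d$ with adjacency matrices $A_0,\dots,A_d$, primitive idempotents $E_0=\frac1{|X|}J,E_1,\dots,E_d$, multiplicities $m_i=\mathrm{rank}\,E_i$ and first eigenmatrix entries $P_i(j)$. Put $\theta_i=P_1(i)$ and suppose $\theta_0,\dots,\theta_d$ are mutually distinct. Let $p_0,\dots,p_d$ be the predistance polynomials of the graph $(X,R_1)$. Then the following are equivalent: (1) $\mathfrak{X}$ is a $P$-polynomial association scheme with respect to $A_1$. (2) There exists $l\in\{0,1,\dots,d\}$ such that $p_d(\theta_h)=P_l(h)$ for each $h\in\{0,1,\dots,d\}$.
   Context: A symmetric association scheme $\mathfrak{X}=(X,\{R_i\}_{i=0}^d)$ of class $d$ consists of a finite set $X$ and binary relations $R_0,\dots,R_d$ on $X$ such that $R_0=\{(x,x):x\in X\}$, the $R_i$ partition $X\times X$, each $R_i$ is symmetric, and for all $i,j,k$ the number $p^k_{i,j}=|\{z:(x,z)\in R_i,(z,y)\in R_j\}|$ is independent of the choice of $(x,y)\in R_k$. The adjacency matrix $A_i$ is the 0/1 matrix of $R_i$. The Bose–Mesner algebra spanned by the $A_i$ has primitive idempotents $E_0=\frac1{|X|}J,E_1,\dots,E_d$, and $A_i=\sum_j P_i(j)E_j$. The scheme is $P$-polynomial with respect to $A_1$ if for some ordering $A_0,A_1,A_{\xi_2},\dots,A_{\xi_d}$ of its adjacency matrices there are polynomials $v_i$ of degree $i$ with $A_{\xi_i}=v_i(A_1)$ for all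 $i$ (with $\xi_0=0,\xi_1=1$). Predistance polynomials: the graph $(X,R_1)$ has adjacency matrix $A_1$ with distinct eigenvalues $\theta_0,\dots,\theta_d$ of multiplicities $m_0,\dots,m_d$. With $Z(t)=\prod_{i=0}^d(t-\theta_i)$, define on $\mathbb{R}[t]/(Z)$ the inner product $\langle p,q\rangle=\frac1{|X|}\sum_{i=0}^d m_i p(\theta_i)q(\theta_i)$. The predistance polynomials $p_0,\dots,p_d$ are the unique polynomials with $\deg p_i=i$ and $\langle p_i,p_j\rangle=\delta_{i,j}p_i(\theta_0)$ for all $i,j$. *)

(* Defs.v *)
From HB Require Import structures.
From mathcomp Require Import all_boot all_order all_fingroup all_algebra.
From mathcomp Require Import reals.

Set Implicit Arguments.
Unset Strict Implicit.
Unset Printing Implicit Defensive.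

Import Order.TTheory GRing.Theory Num.Theory.
Local Open Scope ring_scope.

Record assoc_scheme (X : finType) (d : nat) := AssocScheme {
  srel :> 'I_d.+1 -> {set X * X};
  srel_diag : srel ord0 = [set xy | xy.1 == xy.2];
  srel_nonempty : forall i, srel i != set0;
  srel_disjoint : forall i j, i != j -> [disjoint srel i & srel j];
  srel_cover : \bigcup_i srel i = [set: X * X];
  srel_sym : forall i x y, ((x, y) \in srel i) = ((y, x) \in srel i);
  srel_regular : forall i j k x y x' y',
    (x, y) \in srel k -> (x', y') \in srel k ->
    #|[set z | ((x, z) \in srel i) && ((z, y) \in srel j)]|
    = #|[set z | ((x', z) \in srel i) && ((z, y') \in srel j)]| }.

(* Has value 1 only when 0 < d. *)
Definition idx1 (d : nat) : 'I_d.+1 := inord 1.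

Section Scheme.
Variables (R : realType) (X : finType) (d : nat) (S : assoc_scheme X d).

(* Rows and columns are indexed by X through the enumeration enum_val. *)
Definition adjmx (i : 'I_d.+1) : 'M[R]_#|X| :=
  \matrix_(a, b) ((enum_val a, enum_val b) \in S i)%:R.

Definition bose_mesner (M : 'M[R]_#|X|) : Prop :=
  exists c : 'I_d.+1 -> R, M = \sum_i c i *: adjmx i.

Definition bm_idempotent (M : 'M[R]_#|X|) : Prop :=
  bose_mesner M /\ M *m M = M.

Definition bm_primitive_idempotent (M : 'M[R]_#|X|) : Prop :=
  [/\ bm_idempotent M, M != 0 &
      forall F G, bm_idempotent F -> bm_idempotent G ->
        F *m G = 0 -> G *m F = 0 -> M = F + G -> F = 0 \/ G = 0].

(* E lists all the primitive idempotents, without repetition, with J/|X| as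
   E_0. *)
Definition primitive_idempotents (E : 'I_d.+1 -> 'M[R]_#|X|) : Prop :=
  [/\ E ord0 = const_mx (#|X|%:R^-1),
      injective E &
      forall M, bm_primitive_idempotent M <-> exists i, M = E i].

(* P i j is P_i(j), i.e. the (j, i) entry of the first eigenmatrix. *)
Definition first_eigenmatrix (E : 'I_d.+1 -> 'M[R]_#|X|)
    (P : 'I_d.+1 -> 'I_d.+1 -> R) : Prop :=
  forall i, adjmx i = \sum_j P i j *: E j.

(* horner_mx is only available for matrices of size n.+1. *)
Definition poly_mx (n : nat) (p : {poly R}) (A : 'M[R]_n) : 'M[R]_n :=
  \sum_(k < size p) p`_k *: A ^+ k.

Definition P_polynomial : Prop :=
  exists (xi : {perm 'I_d.+1}) (v : 'I_d.+1 -> {poly R}),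
    [/\ xi ord0 = ord0, xi (idx1 d) = idx1 d &
        forall i : 'I_d.+1,
          size (v i) = i.+1 /\ adjmx (xi i) = poly_mx (v i) (adjmx (idx1 d))].

End Scheme.

Section Predistance.
Variables (R : realType) (d n : nat).
Variables (theta : 'I_d.+1 -> R) (m : 'I_d.+1 -> nat).

(* Depends on p and q only modulo Z = \prod_i ('X - (theta i)%:P). *)
Definition pd_inner (p q : {poly R}) : R :=
  n%:R^-1 * \sum_i (m i)%:R * p.[theta i] * q.[theta i].

Definition predistance (p : 'I_d.+1 -> {poly R}) : Prop :=
  (forall i : 'I_d.+1, size (p i) = i.+1) /\
  (forall i j, pd_inner (p i) (p j) = (i == j)%:R * (p i).[theta ord0]).

End Predistance.

(* Main.v *)
Require Import Defs.
From HB Require Import structures.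
From mathcomp Require Import all_boot all_order all_fingroup all_algebra.
From mathcomp Require Import reals.
Set Implicit Arguments.
Unset Strict Implicit.
Unset Printing Implicit Defensive.
Import Order.TTheory GRing.Theory Num.Theory.
Local Open Scope ring_scope.

(** The adjacency algebra is handled through the values [P i j] of [A_i] on the
    eigenspaces of the [E_j]: the form [pd_inner] becomes the trace form
    [tr (M N) / |X|], for which the [A_i] are orthogonal with squared norm
    [P i 0], the valency.

    (1) => (2): if [A_(xi i) = v_i(A_1)] with [v_i] of degree [i], then the [v_i]
    satisfy the defining relations of the predistance polynomials, so
    [p_d = v_d].

    (2) => (1): let [N_k] be the set of the [i] such that [A_i] occurs in
    [(1 + A_1)^k], i.e. such that [R_i] is at distance at most [k] in the graph
    [R_1].  Since [A_l = p_d(A_1)] is orthogonal to [(1 + A_1)^k] exactly when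
    [k < d], [l] first appears in [N_d].  As [N_k] determines [N_(k+1)], the chain
    [N_0 < N_1 < ... < N_d] is strict, and having only [d + 1] indices it gains
    exactly one index [xi k] at each step.  The expansion of [(1 + A_1)^k] is then
    triangular and can be inverted to make [A_(xi k)] a polynomial of degree [k]
    in [A_1]. *)

(** * Idempotent matrices and leading coefficients *)

Lemma mxtrace_idempotent (F : fieldType) (n : nat) (M : 'M[F]_n) :
  M *m M = M -> \tr M = (\rank M)%:R.
Proof.
(* In the full-rank factorization [M = C R], the outer factors cancel from [C R C R = C R], so [R C]
   is the identity of size [\rank M]; the trace is cyclic. *)
move=> MM; have rc1 : row_base M *m col_base M = 1%:M.
  apply: (row_full_inj (col_base_full M)); apply: (row_free_inj (row_base_free M)).
  by rewrite /= mulmx1 mulmxA mulmx_base -mulmxA mulmx_base.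
by rewrite -[M in LHS]mulmx_base mxtrace_mulC rc1 mxtrace1.
Qed.

Lemma coef_size_pred_neq0 (F : nzRingType) (q : {poly F}) (k : nat) :
  size q = k.+1 -> q`_k != 0.
Proof.
move=> sq; have : lead_coef q != 0 by rewrite lead_coef_eq0 -size_poly_eq0 sq.
by rewrite lead_coefE sq.
Qed.

Lemma size_sub_scale_lead (F : fieldType) (q r : {poly F}) (k : nat) :
  size q = k.+1 -> size r = k.+1 ->
  (size (q - (q`_k / r`_k) *: r)%R <= k)%N.
Proof.
move=> sq sr; have r0 := coef_size_pred_neq0 sr.
apply/leq_sizeP => i; rewrite leq_eqVlt => /predU1P[<-|ki].
  by rewrite coefB coefZ divfK // subrr.
by rewrite coefB coefZ [q`_i]nth_default ?[r`_i]nth_default ?sq ?sr // mulr0 subrr.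
Qed.

(** * The inner product defining the predistance polynomials *)

Section PdInner.
Variables (R : realType) (d n : nat) (theta : 'I_d.+1 -> R) (m : 'I_d.+1 -> nat).
Notation inner := (pd_inner n theta m).

Lemma pd_innerC p q : inner p q = inner q p.
Proof.
by congr (_ * _); apply: eq_bigr => i _; rewrite mulrAC.
Qed.

Lemma pd_innerDr p q r : inner p (q + r) = inner p q + inner p r.
Proof.
rewrite /pd_inner -mulrDr -big_split /=; congr (_ * _).
by apply: eq_bigr => i _; rewrite hornerD mulrDr.
Qed.

Lemma pd_innerZr p a q : inner p (a *: q) = a * inner p q.
Proof.
rewrite /pd_inner [RHS]mulrCA; congr (_ * _); rewrite mulr_sumr.
by apply: eq_bigr => i _; rewrite hornerZ mulrCA.
Qed.

Lemma pd_innerBr p q r : inner p (q - r) = inner p q - inner p r.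
Proof. by rewrite -scaleN1r pd_innerDr pd_innerZr mulN1r. Qed.

Lemma pd_inner_eq0 p : (0 < n)%N -> (forall j, (0 < m j)%N) ->
  inner p p = 0 -> forall j, p.[theta j] = 0.
Proof.
move=> n0 m0 /eqP; rewrite mulf_eq0 invr_eq0 pnatr_eq0 gtn_eqF //= => /eqP s0 j.
have /psumr_eq0P : forall i, true -> 0 <= (m i)%:R * p.[theta i] * p.[theta i].
  by move=> i _; rewrite -mulrA mulr_ge0 // -expr2 sqr_ge0.
move=> /(_ s0 j isT)/eqP; rewrite -mulrA mulf_eq0 pnatr_eq0 gtn_eqF //=.
by rewrite mulf_eq0 orbb => /eqP.
Qed.

(** Induction on the degree of [q]: subtracting a multiple of the [v i] of the same degree lowers
    it, and [v k] is orthogonal to that [v i] because [i < k]. *)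
Lemma orthogonal_to_lower_degree (v : 'I_d.+1 -> {poly R}) (k : 'I_d.+1) :
  (forall i : 'I_d.+1, size (v i) = i.+1) ->
  (forall i j, i != j -> inner (v i) (v j) = 0) ->
  forall q : {poly R}, (size q <= k)%N -> inner (v k) q = 0.
Proof.
move=> sv ov q; move: {2}(size q) (leqnn (size q)) => s.
elim: s q => [|s IH] q.
  rewrite leqn0 size_poly_eq0 => /eqP-> _.
  by rewrite -(scale0r 0) pd_innerZr mul0r.
rewrite leq_eqVlt => /predU1P[sq|]; last by rewrite ltnS; apply: IH.
rewrite sq => sk; have sd : (s < d.+1)%N := ltn_trans sk (ltn_ord k).
pose i := Ordinal sd.
have le := size_sub_scale_lead sq (sv i).
rewrite -(subrK ((q`_s / (v i)`_s) *: v i) q) pd_innerDr.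
rewrite IH ?(leq_trans le) ?(ltnW sk) //.
by rewrite pd_innerZr ov ?mulr0 ?addr0 // -val_eqE /= gtn_eqF.
Qed.

End PdInner.

(** With [c] the ratio of leading coefficients, [p_d - c v_d] has degree below [d], hence is
    orthogonal to itself and vanishes at every [theta j]. The two normalizations then give
    [c^2 K = c K], so [c = 1]. *)
Lemma top_poly_unique (R : realType) (d n : nat) (theta : 'I_d.+1 -> R)
    (m : 'I_d.+1 -> nat) (p v : 'I_d.+1 -> {poly R}) (K : R) :
  (0 < n)%N -> (forall j, (0 < m j)%N) -> 0 < K ->
  predistance n theta m p -> (forall i : 'I_d.+1, size (v i) = i.+1) ->
  (forall i j, i != j -> pd_inner n theta m (v i) (v j) = 0) ->
  pd_inner n theta m (v ord_max) (v ord_max) = K ->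
  (v ord_max).[theta ord0] = K ->
  forall j, (p ord_max).[theta j] = (v ord_max).[theta j].
Proof.
move=> n0 m0 K0 [sp op] sv ov vK v0.
set pd := p ord_max; set vd := v ord_max in vK v0 *.
set c := pd`_d / vd`_d.
have c0 : c != 0 by rewrite mulf_neq0 ?invr_eq0 ?coef_size_pred_neq0 // ?sp ?sv.
have sr : (size (pd - c *: vd)%R <= d)%N by apply: size_sub_scale_lead; rewrite ?sp ?sv.
have rr : pd_inner n theta m (pd - c *: vd) (pd - c *: vd) = 0.
  have opd : forall i j, i != j -> pd_inner n theta m (p i) (p j) = 0.
    by move=> i j /negPf ij; rewrite op ij mul0r.
  rewrite pd_innerBr pd_innerZr ![pd_inner _ _ _ (_ - _) _]pd_innerC.
  by rewrite !(@orthogonal_to_lower_degree _ _ _ _ _ _ ord_max) // mulr0 subrr.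
have r0 j : pd.[theta j] = c * vd.[theta j].
  by apply/eqP; rewrite -hornerZ -subr_eq0 -hornerN -hornerD (pd_inner_eq0 n0 m0 rr).
have := op ord_max ord_max.
have -> : pd_inner n theta m pd pd = c * (c * K).
  rewrite -vK -[in RHS]pd_innerZr pd_innerC -pd_innerZr /pd_inner; congr (_ * _).
  by apply: eq_bigr => j _; rewrite r0 !hornerZ.
rewrite eqxx mul1r r0 v0 => /(mulfI c0)/esym; rewrite -[LHS]mul1r.
by move=> /(mulIf (lt0r_neq0 K0)) c1 j; rewrite r0 -c1 mul1r.
Qed.

(** * Walks along [R_1], read from a table of eigenvalues *)

Section Eigentable.
Variables (R : realType) (d n : nat) (m : 'I_d.+1 -> nat).
Variables (P B : 'I_d.+1 -> 'I_d.+1 -> R).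
Notation theta := (P (idx1 d)).

(** This is [pd_inner] on vectors of values, so that it applies to rows of [P] before they are known
    to be polynomials in [theta]. *)
Definition row_inner (u w : 'I_d.+1 -> R) : R :=
  n%:R^-1 * \sum_j (m j)%:R * u j * w j.

(** The properties of a scheme on which the walk argument rests; [B i k] stands for [p^k_(1,i)]. *)
Definition is_eigentable : Prop :=
  [/\ (forall j, P ord0 j = 1),
      (forall i k, 0 <= B i k),
      (forall i j, theta j * P i j = \sum_k B i k * P k j),
      (forall i, 0 < P i ord0) &
      (forall i k, row_inner (P i) (P k) = (i == k)%:R * P i ord0)].

(* The coordinates of (1 + A_1)^k on the A_i when B j i = p^i_(1,j). *)
Fixpoint walk_coef (k : nat) : 'I_d.+1 -> R :=
  if k is k'.+1 then
    fun i => walk_coef k' i + \sum_j walk_coef k' j * B j i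
  else fun i => (i == ord0)%:R.

Definition walk_supp (k : nat) : {set 'I_d.+1} := [set i | walk_coef k i != 0].

Definition grow (N : {set 'I_d.+1}) : {set 'I_d.+1} :=
  N :|: [set i | [exists j in N, B j i != 0]].

Variable tab : is_eigentable.

Lemma eq_row_inner u u' w : u =1 u' -> row_inner u w = row_inner u' w.
Proof. by move=> uu; congr (_ * _); apply: eq_bigr => j _; rewrite uu. Qed.

Lemma row_inner_lin (a : 'I_d.+1 -> R) l :
  row_inner (fun j => \sum_i a i * P i j) (P l) = a l * P l ord0.
Proof.
have [_ _ _ _ oP] := tab.
transitivity (\sum_i a i * row_inner (P i) (P l)).
  rewrite /row_inner; under [in RHS]eq_bigr do rewrite mulrCA mulr_sumr.
  rewrite -mulr_sumr exchange_big /=; congr (_ * _); apply: eq_bigr => j _.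
  rewrite mulr_sumr mulr_suml; apply: eq_bigr => i _.
  by rewrite !mulrA [_ * a i]mulrC.
rewrite (bigD1 l) //= oP eqxx mul1r big1 ?addr0 // => i /negPf il.
by rewrite oP il mul0r mulr0.
Qed.

Lemma walk_coefE k j : (1 + theta j) ^+ k = \sum_i walk_coef k i * P i j.
Proof.
have [P0 _ PM _ _] := tab.
elim: k => [|k IH] /=.
  rewrite (bigD1 ord0) //= mul1r P0 big1 ?addr0 // => i /negPf i0.
  by rewrite i0 mul0r.
rewrite exprS IH mulrDl mul1r mulr_sumr.
under [RHS]eq_bigr do rewrite mulrDl mulr_suml.
rewrite big_split /= exchange_big /=; congr (_ + _); apply: eq_bigr => i _.
by rewrite mulrCA PM mulr_sumr; apply: eq_bigr => k' _; rewrite mulrA.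
Qed.

Lemma walk_coef_inner k l :
  row_inner (fun j => (1 + theta j) ^+ k) (P l) = walk_coef k l * P l ord0.
Proof. by rewrite -row_inner_lin; apply: eq_row_inner => j; rewrite walk_coefE. Qed.

Lemma walk_coef_ge0 k i : 0 <= walk_coef k i.
Proof.
have [_ B0 _ _ _] := tab.
elim: k i => [|k IH] i /=; first exact: ler0n.
by rewrite addr_ge0 // sumr_ge0 // => j _; rewrite mulr_ge0.
Qed.

(* Nonnegativity rules out cancellation, so a support determines the next. *)
Lemma walk_suppS k : walk_supp k.+1 = grow (walk_supp k).
Proof.
have [_ B0 _ _ _] := tab.
have t0 i j : true -> 0 <= walk_coef k j * B j i.
  by move=> _; rewrite mulr_ge0 ?walk_coef_ge0.
apply/setP=> i; rewrite !inE /=.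
rewrite paddr_eq0 ?walk_coef_ge0 ?sumr_ge0 ?negb_and //; last by move=> j; apply: t0.
congr (_ || _); apply/idP/existsP => [|[j]].
  rewrite psumr_neq0; last by move=> j; apply: t0.
  case/hasP=> j _ /= /lt0r_neq0; rewrite mulf_eq0 negb_or => /andP[cj bj].
  by exists j; rewrite inE cj.
rewrite inE => /andP[cj bj]; apply/negP => /eqP /psumr_eq0P s0.
by have /eqP := s0 (t0 i) j isT; rewrite mulf_eq0 (negPf cj) (negPf bj).
Qed.

Lemma walk_supp_mono k k' : (k <= k')%N -> walk_supp k \subset walk_supp k'.
Proof.
move=> /subnKC <-; elim: (k' - k)%N => [|t IH]; first by rewrite addn0.
by rewrite addnS walk_suppS (subset_trans IH) // subsetUl.
Qed.

Lemma walk_supp_stable k t : walk_supp k = walk_supp k.+1 ->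
  walk_supp (k + t) = walk_supp k.
Proof.
move=> st; elim: t => [|t IH]; first by rewrite addn0.
by rewrite addnS walk_suppS IH -walk_suppS.
Qed.

(** As [P ord0] is constantly 1, [B ord0] gives the coordinates of [theta] itself, and orthogonality
    of the rows leaves only the one at [idx1 d]. *)
Lemma walk_supp1 i : i \in walk_supp 1 -> i != ord0 -> i = idx1 d.
Proof.
have [P0 _ PM Pp oP] := tab.
rewrite walk_suppS !inE /= => /orP[|/existsP[j /andP[]]].
  by case: (i == ord0) => //; rewrite eqxx.
rewrite inE /=; case: (j =P ord0) => [->|]; last by rewrite eqxx.
move=> _ b0 _; apply/eqP; have := row_inner_lin (B ord0) i.
rewrite -(@eq_row_inner theta); last by move=> h; rewrite -PM P0 mulr1.
rewrite oP eq_sym; case: eqP => // _ /esym/eqP.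
by rewrite mul0r mulf_eq0 (negPf b0) (gt_eqF (Pp i)).
Qed.

(* If a relation is first reached after exactly d steps, then each step reaches
   a new relation; as there are d + 1 relations, each step reaches just one. *)
Lemma far_relation_order l :
  (0 < d)%N -> (forall k, (k < d)%N -> l \notin walk_supp k) ->
  l \in walk_supp d ->
  exists xi : {perm 'I_d.+1}, [/\ xi ord0 = ord0, xi (idx1 d) = idx1 d &
    forall k i : 'I_d.+1, (xi i \in walk_supp k) = (i <= k)%N].
Proof.
move=> d0 lN lin.
have ex (i : 'I_d.+1) : exists x, x \in walk_supp i /\
    forall k, (k < i)%N -> x \notin walk_supp k.
  case: (posnP i) => [->|i0].
    by exists ord0; split=> //; rewrite inE oner_eq0.
  have /properP[_ [x xi xp]] : walk_supp i.-1 \proper walk_supp i.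
    rewrite properEneq walk_supp_mono ?leq_pred // andbT.
    (* If step [i] gained nothing, the chain would be constant from [i - 1] on, and [l] would
       already occur before step [d]. *)
    apply/eqP => st; have lid : (i.-1 < d)%N by rewrite prednK // -ltnS.
    have := @walk_supp_stable i.-1 (d - i.-1); rewrite prednK // => /(_ st).
    by rewrite (subnKC (ltnW lid)) => E; move: lin; rewrite E (negPf (lN _ lid)).
  exists x; split=> // k ki; apply: contra xp; apply/subsetP/walk_supp_mono.
  by rewrite -ltnS prednK.
have [f fP] := fin_all_exists ex.
have fk (i : 'I_d.+1) k : (f i \in walk_supp k) = (i <= k)%N.
  have [fi fn] := fP i; case: leqP => [ik|/fn/negPf //].
  exact: (subsetP (walk_supp_mono ik)).
have finj : injective f.
  move=> i j fij; apply/val_inj/eqP; rewrite eqn_leq.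
  by rewrite -fk fij (fP j).1 -fk -fij (fP i).1.
have f0 : f ord0 = ord0.
  by have := fk ord0 0%N; rewrite inE /=; case: (f ord0 =P ord0) => //; rewrite eqxx.
exists (perm finj); rewrite !permE; split=> // [|k i]; last by rewrite permE.
(* Since [0 < d], [idx1 d] really is the index 1: its image lies in [walk_supp 1] and differs from
   [ord0]. *)
apply: walk_supp1; first by rewrite fk /= inordK.
rewrite -f0 (inj_eq finj) -val_eqE /= inordK //.
Qed.

(** Along [xi], [(1 + theta)^i] combines the rows [P (xi h)] with [h <= i], with nonzero coefficient
    at [h = i]. By strong induction the lower rows are polynomials of degree below [i], so
    [P (xi i)] can be solved for. *)
Lemma triangular_polynomials (xi : {perm 'I_d.+1}) :
  (forall k i : 'I_d.+1, (xi i \in walk_supp k) = (i <= k)%N) ->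
  forall i : 'I_d.+1, exists v : {poly R},
    size v = i.+1 /\ forall j, v.[theta j] = P (xi i) j.
Proof.
move=> xiP i; have [k ik] := ubnP (val i); elim: k i ik => // k IH i ik.
have lower (h : 'I_d.+1) : exists v : {poly R}, (h < i)%N ->
    size v = h.+1 /\ forall j, v.[theta j] = P (xi h) j.
  case: (ltnP h i) => [hi|]; last by exists 0.
  by have [v vP] := IH h (leq_trans hi ik); exists v.
have [w wP] := fin_all_exists lower.
have ci : walk_coef i (xi i) != 0 by have := xiP i i; rewrite inE leqnn.
pose r := \sum_(h : 'I_d.+1 | (h < i)%N) walk_coef i (xi h) *: w h.
have sr : (size r < i.+1)%N.
  rewrite ltnS (leq_trans (size_sum _ _ _)) //; apply/bigmax_leqP => h hi.
  by rewrite (leq_trans (size_scale_leq _ _)) // (wP h hi).1.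
(* ['X - (-1)%:P] is [1 + 'X], in the shape to which [size_exp_XsubC] applies. *)
have sX : size (('X - (-1)%:P) ^+ i : {poly R}) = i.+1 by rewrite size_exp_XsubC.
exists ((walk_coef i (xi i))^-1 *: (('X - (-1)%:P) ^+ i - r)); split=> [|j].
  by rewrite size_scale ?invr_eq0 // size_polyDl sX ?size_polyN.
rewrite hornerZ hornerD hornerN horner_exp hornerXsubC opprK.
rewrite [theta j + 1]addrC walk_coefE (reindex_inj (@perm_inj _ xi)) /=.
have -> : r.[theta j] =
    \sum_(h : 'I_d.+1 | (h < i)%N) walk_coef i (xi h) * P (xi h) j.
  by rewrite horner_sum; apply: eq_bigr => h hi; rewrite hornerZ (wP h hi).2.
rewrite (bigID (fun h : 'I_d.+1 => (h < i)%N)) /= [X in X - _]addrC addrK.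
rewrite (bigD1 i) ?ltnn //= big1 ?addr0 ?mulKf //.
(* Here [h > i], so [xi h] lies outside [walk_supp i] and its coefficient vanishes. *)
move=> h /andP[hi nhi]; have := xiP i h.
by rewrite inE leq_eqVlt val_eqE (negPf nhi) (negPf hi) => /negbFE/eqP->; rewrite mul0r.
Qed.

End Eigentable.

(** * The Bose-Mesner algebra and its multiplication *)

Lemma sum_enum_val (V : nmodType) (X : finType) (F : X -> V) :
  \sum_z F z = \sum_(c < #|X|) F (enum_val c).
Proof. by rewrite -(big_enum_val F); apply: eq_bigl. Qed.

Section BoseMesner.
Variables (R : realType) (X : finType) (d : nat) (S : assoc_scheme X d).
Notation A := (adjmx R S).
Notation BM := (@bose_mesner R X d S).

Lemma srel_index x y : exists k, (x, y) \in S k.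
Proof.
have : (x, y) \in \bigcup_i S i by rewrite srel_cover inE.
by case/bigcupP=> k _; exists k.
Qed.

Lemma srel_unique i k xy : xy \in S i -> xy \in S k -> i = k.
Proof.
move=> xi xk; apply/eqP; apply: contraTT xk => /(srel_disjoint S).
by move/disjointFr => ->.
Qed.

(** Counted at one chosen pair of [S k]; by [srel_nonempty] the default 0 is never taken. *)
Definition intersection_number (i j k : 'I_d.+1) : nat :=
  if [pick xy in S k] is Some xy then
    #|[set z | ((xy.1, z) \in S i) && ((z, xy.2) \in S j)]|
  else 0%N.

Lemma intersection_numberE i j k x y : (x, y) \in S k ->
  #|[set z | ((x, z) \in S i) && ((z, y) \in S j)]| = intersection_number i j k.
Proof.
rewrite /intersection_number => xy; case: pickP => [[x' y'] xy'|/(_ (x, y))].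
  exact: srel_regular xy xy'.
by rewrite xy.
Qed.

Lemma adjmx_sum_entry (c : 'I_d.+1 -> R) k a b :
  (enum_val a, enum_val b) \in S k -> (\sum_i c i *: A i) a b = c k.
Proof.
move=> abk; rewrite summxE (bigD1 k) //= !mxE abk mulr1 big1 ?addr0 // => i ik.
rewrite !mxE; case abi: (_ \in S i); last by rewrite mulr0.
by rewrite (srel_unique abi abk) eqxx in ik.
Qed.

Lemma adjmxM i j :
  A i *m A j = \sum_k (intersection_number i j k)%:R *: A k.
Proof.
apply/matrixP=> a b; have [k abk] := srel_index (enum_val a) (enum_val b).
rewrite (adjmx_sum_entry _ abk) -(intersection_numberE i j abk) mxE -sum1_card.
rewrite natr_sum [RHS]big_mkcond /= [RHS]sum_enum_val.
apply: eq_bigr => c _; rewrite !mxE inE -natrM mulnb.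
by case: (_ && _).
Qed.

Lemma adjmx0 : A ord0 = 1%:M.
Proof. by apply/matrixP=> a b; rewrite !mxE srel_diag inE /= (inj_eq enum_val_inj). Qed.

Lemma bose_mesnerB M N : BM M -> BM N -> BM (M - N).
Proof.
move=> [c ->] [e ->]; exists (fun i => c i - e i).
by rewrite -sumrB; apply: eq_bigr => i _; rewrite scalerBl.
Qed.

Lemma bose_mesnerM M N : BM M -> BM N -> BM (M *m N).
Proof.
move=> [c ->] [e ->].
exists (fun k => \sum_i \sum_j c i * e j * (intersection_number i j k)%:R).
rewrite mulmx_suml; under [RHS]eq_bigr do rewrite scaler_suml.
rewrite [RHS]exchange_big; apply: eq_bigr => i _ /=.
rewrite mulmx_sumr; under [RHS]eq_bigr do rewrite scaler_suml.
rewrite [RHS]exchange_big; apply: eq_bigr => j _ /=.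
rewrite -scalemxAl -scalemxAr adjmxM scalerA scaler_sumr.
by apply: eq_bigr => k _; rewrite scalerA.
Qed.

Lemma bose_mesner_sym M : BM M -> M^T = M.
Proof.
move=> [c ->]; rewrite raddf_sum; apply: eq_bigr => i _ /=; rewrite linearZ /=.
by congr (_ *: _); apply/matrixP=> a b; rewrite !mxE srel_sym.
Qed.

(** All elements of the algebra, products included, are symmetric, and transposition swaps the
    factors. *)
Lemma bose_mesnerC M N : BM M -> BM N -> M *m N = N *m M.
Proof.
move=> bM bN; rewrite -[LHS](bose_mesner_sym (bose_mesnerM bM bN)) trmx_mul.
by rewrite !bose_mesner_sym.
Qed.

(** [M = M N + (M - M N)] splits [M] into orthogonal idempotents of the algebra, so primitivity
    kills one of them. *)
Lemma bm_primitive_absorb (M N : 'M[R]_#|X|) : bm_primitive_idempotent S M ->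
  bm_idempotent S N -> M *m N = 0 \/ M *m N = M.
Proof.
move=> [[bM MM] _ pM] [bN NN]; have MNC := bose_mesnerC bM bN.
have MNM : M *m N *m M = M *m N by rewrite -mulmxA -MNC mulmxA MM.
have MNN : M *m N *m (M *m N) = M *m N by rewrite mulmxA MNM -mulmxA NN.
have MMN : M *m (M *m N) = M *m N by rewrite mulmxA MM.
have := pM (M *m N) (M - M *m N); case.
- by split=> //; apply: bose_mesnerM.
- split; first exact: bose_mesnerB (bose_mesnerM bM bN).
  by rewrite mulmxBl !mulmxBr MM MMN MNM MNN subrr subr0.
- by rewrite mulmxBr MNM MNN subrr.
- by rewrite mulmxBl MMN MNN subrr.
- by rewrite addrC subrK.
- by left.
- by move=> /eqP; rewrite subr_eq0 => /eqP <-; right.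
Qed.

(** * Primitive idempotents and the first eigenmatrix *)

Variables (E : 'I_d.+1 -> 'M[R]_#|X|) (P : 'I_d.+1 -> 'I_d.+1 -> R).
Variable hE : primitive_idempotents S E.
Variable hP : first_eigenmatrix S E P.

Lemma idempotent_primitive i : bm_primitive_idempotent S (E i).
Proof. by have [_ _ hM] := hE; apply/hM; exists i. Qed.

Lemma idempotent_neq0 i : E i != 0.
Proof. by have [] := idempotent_primitive i. Qed.

Lemma idempotent_mul i j : E i *m E j = (i == j)%:R *: E i.
Proof.
have [[bi ii] i0 _] := idempotent_primitive i.
have [[bj jj] j0 _] := idempotent_primitive j.
case: eqP => [<-|ij]; first by rewrite ii scale1r.
rewrite scale0r; case: (@bm_primitive_absorb (E i) (E j)) => //.
- exact: idempotent_primitive.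
- case: (@bm_primitive_absorb (E j) (E i)) => //.
  + exact: idempotent_primitive.
  + by rewrite bose_mesnerC.
  + rewrite bose_mesnerC // => -> Eij; have [_ Einj _] := hE.
    by case: ij; apply: Einj.
Qed.

Lemma idempotent_mul_sum (c : 'I_d.+1 -> R) i :
  (\sum_j c j *: E j) *m E i = c i *: E i.
Proof.
rewrite mulmx_suml (bigD1 i) //= -scalemxAl idempotent_mul eqxx scale1r.
rewrite big1 ?addr0 // => j /negPf ji.
by rewrite -scalemxAl idempotent_mul ji scale0r scaler0.
Qed.

Lemma idempotent_scaleI i : injective (fun c : R => c *: E i).
Proof.
move=> a b /eqP; rewrite -subr_eq0 -scalerBl scaler_eq0 (negPf (idempotent_neq0 i)).
by rewrite orbF subr_eq0 => /eqP.
Qed.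

Lemma idempotent_coef_inj (c e : 'I_d.+1 -> R) :
  \sum_j c j *: E j = \sum_j e j *: E j -> c =1 e.
Proof.
by move=> ce i; apply: (@idempotent_scaleI i); rewrite -!idempotent_mul_sum ce.
Qed.

Lemma eigenmatrix0 j : P ord0 j = 1.
Proof.
apply: (@idempotent_scaleI j).
by rewrite -idempotent_mul_sum -hP adjmx0 mul1mx scale1r.
Qed.

(** The expansion of [A_0 = 1] supplies completeness of the idempotents, which
    [primitive_idempotents] does not state. *)
Lemma idempotent_sum : \sum_j E j = 1%:M.
Proof.
by rewrite -adjmx0 hP; apply: eq_bigr => j _; rewrite eigenmatrix0 scale1r.
Qed.

Lemma adjmx_idempotent i j : A i *m E j = P i j *: E j.
Proof. by rewrite hP idempotent_mul_sum. Qed.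

Lemma eigenmatrixM i k j :
  P i j * P k j = \sum_h (intersection_number i k h)%:R * P h j.
Proof.
apply: (@idempotent_scaleI j); rewrite mulrC -scalerA -adjmx_idempotent.
rewrite scalemxAr -adjmx_idempotent mulmxA adjmxM mulmx_suml scaler_suml.
by apply: eq_bigr => h _; rewrite -scalemxAl adjmx_idempotent scalerA.
Qed.

Lemma scheme_point_gt0 : (0 < #|X|)%N.
Proof. by have /set0Pn[[x _] _] := srel_nonempty S ord0; apply/card_gt0P; exists x. Qed.

(** [E ord0] is a constant matrix, so a row sum is the eigenvalue of [A i] on the all-ones
    vector. *)
Lemma adjmx_row_sum i a : \sum_b A i a b = P i ord0.
Proof.
have n0 : #|X|%:R^-1 != 0 :> R by rewrite invr_eq0 pnatr_eq0 -lt0n scheme_point_gt0.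
have [E0 _ _] := hE; apply: (mulIf n0); rewrite mulr_suml.
transitivity ((A i *m E ord0) a a).
  by rewrite mxE; apply: eq_bigr => b _; rewrite E0 [const_mx _ _ _]mxE.
by rewrite adjmx_idempotent E0 2!mxE.
Qed.

Lemma valency_gt0 i : 0 < P i ord0.
Proof.
have /set0Pn[[x y] xy] := srel_nonempty S i.
rewrite -(adjmx_row_sum i (enum_rank x)) (bigD1 (enum_rank y)) //=.
rewrite mxE !enum_rankK xy ltr_wpDr ?ltr01 // sumr_ge0 // => b _.
by rewrite mxE ler0n.
Qed.

Lemma adjmxM_trace i k : \tr (A i *m A k) = (i == k)%:R * (#|X|%:R * P i ord0).
Proof.
transitivity (\sum_(a < #|X|) (i == k)%:R * P i ord0); last first.
  by rewrite sumr_const card_ord [#|X|%:R * _]mulr_natl mulrnAr.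
apply: eq_bigr => a _; rewrite -(adjmx_row_sum i a) mulr_sumr mxE.
apply: eq_bigr => b _; rewrite !mxE -natrM [(_, _) \in S k]srel_sym.
case abi: (_ \in S i); last by rewrite mulr0.
rewrite mul1n mulr1; congr (_%:R).
case: eqP => [<-|ik]; first by rewrite abi.
by case abk: (_ \in S k) => //; case: ik; apply: srel_unique abk.
Qed.

(** Both sides compute [\tr (A i *m A k) / #|X|]: spectrally, with [\tr (E j)] equal to its rank,
    and by counting entries. *)
Lemma eigenmatrix_orthogonal i k :
  #|X|%:R^-1 * (\sum_j (\rank (E j))%:R * P i j * P k j)
  = (i == k)%:R * P i ord0.
Proof.
have n0 : #|X|%:R != 0 :> R by rewrite pnatr_eq0 -lt0n scheme_point_gt0.
apply: (canLR (mulKf n0)); rewrite mulrCA -adjmxM_trace [A k]hP mulmx_sumr raddf_sum.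
apply: eq_bigr => j _ /=; rewrite -scalemxAr adjmx_idempotent scalerA linearZ /=.
have [[_ /mxtrace_idempotent-> _] _] := idempotent_primitive j.
by rewrite mulrC mulrA mulrAC.
Qed.

Lemma poly_mxE q : poly_mx q (A (idx1 d)) = \sum_j q.[P (idx1 d) j] *: E j.
Proof.
have expA k : A (idx1 d) ^+ k = \sum_j P (idx1 d) j ^+ k *: E j.
  elim: k => [|k IH].
    by rewrite expr0 -[1]/(1%:M) -idempotent_sum; apply: eq_bigr => j _; rewrite scale1r.
  rewrite exprS -[_ * _]/(_ *m _) IH mulmx_sumr; apply: eq_bigr => j _.
  by rewrite -scalemxAr adjmx_idempotent scalerA -exprSr.
rewrite /poly_mx; under eq_bigr do rewrite expA scaler_sumr.
rewrite exchange_big; apply: eq_bigr => j _ /=.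
rewrite horner_coef scaler_suml; apply: eq_bigr => k _.
by rewrite scalerA.
Qed.

Lemma adjmx_polyP i q :
  A i = poly_mx q (A (idx1 d)) <-> forall j, P i j = q.[P (idx1 d) j].
Proof.
rewrite poly_mxE [A i]hP; split=> [/idempotent_coef_inj //|Pq].
by apply: eq_bigr => j _; rewrite Pq.
Qed.

Lemma scheme_eigentable :
  is_eigentable #|X| (fun j => \rank (E j)) P
    (fun i k => (intersection_number (idx1 d) i k)%:R).
Proof.
split=> *; [exact: eigenmatrix0|exact: ler0n|exact: eigenmatrixM|
  exact: valency_gt0|exact: eigenmatrix_orthogonal].
Qed.

End BoseMesner.

Theorem theorem1p2 (R : realType) (X : finType) (d : nat) (hd : (0 < d)%N)
    (S : assoc_scheme X d)
    (E : 'I_d.+1 -> 'M[R]_#|X|) (hE : primitive_idempotents S E)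
    (P : 'I_d.+1 -> 'I_d.+1 -> R) (hP : first_eigenmatrix S E P)
    (htheta : injective (P (idx1 d)))
    (p : 'I_d.+1 -> {poly R})
    (hp : predistance #|X| (P (idx1 d)) (fun i => \rank (E i)) p) :
  P_polynomial R S <->
  exists l : 'I_d.+1, forall h : 'I_d.+1, (p ord_max).[P (idx1 d) h] = P l h.
Proof.
set m := fun i => \rank (E i) in hp.
have tab := scheme_eigentable hE hP; have [_ _ _ Pp oP] := tab.
have n0 := scheme_point_gt0 S.
have m0 j : (0 < m j)%N by rewrite lt0n mxrank_eq0 (idempotent_neq0 hE).
split=> [[xi [v [_ _ vP]]]|[l pl]].
  have vE i j : (v i).[P (idx1 d) j] = P (xi i) j.
    by have [_ /(adjmx_polyP hE hP) ->] := vP i.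
  have vI i j : pd_inner #|X| (P (idx1 d)) m (v i) (v j)
      = (i == j)%:R * P (xi i) ord0.
    rewrite -(inj_eq (@perm_inj _ xi)) -oP; congr (_ * _).
    by apply: eq_bigr => h _; rewrite !vE.
  (* The valency of the last relation serves both as the squared norm of [v_d] and as its value at
     [theta_0]. *)
  exists (xi ord_max) => h; rewrite -vE.
  apply: (top_poly_unique n0 m0 (Pp (xi ord_max)) hp) => [i|i j /negPf ij||].
  - by have [] := vP i.
  - by rewrite vI ij mul0r.
  - by rewrite vI eqxx mul1r.
  - by rewrite vE.
have [sp op] := hp; set pd := p ord_max in pl *.
pose B i k : R := (intersection_number S (idx1 d) i k)%:R.
have pdO (q : {poly R}) : (size q <= d)%N -> pd_inner #|X| (P (idx1 d)) m pd q = 0.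
  apply: (orthogonal_to_lower_degree (k := ord_max) sp) => i j /negPf ij.
  by rewrite op ij mul0r.
(* As [p_d] takes the values [P l], pairing it with [(1 + 'X)^k] detects whether [A_l] occurs in
   [(1 + A_1)^k]. *)
have pdX k : pd_inner #|X| (P (idx1 d)) m pd (('X - (-1)%:P) ^+ k)
    = walk_coef B k l * P l ord0.
  rewrite -(walk_coef_inner tab) pd_innerC; congr (_ * _).
  apply: eq_bigr => j _; rewrite pl horner_exp hornerXsubC opprK.
  by rewrite [_ + 1]addrC.
have lN k : (k < d)%N -> l \notin walk_supp B k.
  move=> kd; have /esym/eqP := pdX k; rewrite pdO ?size_exp_XsubC //.
  by rewrite inE negbK mulf_eq0 (gt_eqF (Pp l)) orbF.
(* Otherwise [p_d] is orthogonal to [(1 + 'X)^d] as well as to all lower degrees, hence to itself,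
   forcing [P l ord0 = 0] against positivity of the valency. *)
have lin : l \in walk_supp B d.
  rewrite inE; apply/negP => /eqP c0; have := pdX d; rewrite c0 mul0r => pX.
  have sX := size_exp_XsubC d (-1 : R).
  have := pdO _ (size_sub_scale_lead (sp ord_max) sX).
  rewrite pd_innerBr pd_innerZr pX mulr0 subr0 => /(pd_inner_eq0 n0 m0)/(_ ord0).
  by rewrite pl => /eqP; rewrite gt_eqF.
have [xi [xi0 xi1 xiP]] := far_relation_order tab hd lN lin.
have [v vP] := fin_all_exists (triangular_polynomials tab xiP).
exists xi, v; split=> // i; have [sv vE] := vP i; split=> //.
by apply/(adjmx_polyP hE hP) => j; rewrite vE.
Qed.
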